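(* Let $\Bbbk$ be a field and let $m\ge2$ and $0\le d<m$ be integers. There exists a monomial ideal $K$ in $R=\Bbbk[x,y,z,u,v]$ such that for all $t\ge1$, $$\operatorname{depth} R/K^{(t)}=\begin{cases}2&\text{if } t\equiv d \pmod m,\\ 1&\text{otherwise.}\end{cases}$$
   Context: For an ideal $Q$ in a Noetherian ring $S$ and $t\ge0$, the $t$-th symbolic power is $Q^{(t)}=\bigcap_{\mathfrak p\in\operatorname{Min}(Q)}(Q^t S_{\mathfrak p}\cap S)$, where $\operatorname{Min}(Q)$ is the set of minimal primes of $Q$. Depth is taken with respect to the maximal homogeneous ideal. *)

(* Defs.v *)
From HB Require Import structures.
From mathcomp Require Import all_boot all_order all_algebra.
From mathcomp Require Import mpoly.
Set Implicit Arguments. Unset Strict Implicit. Unset Printing Implicit Defensive.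
Import GRing.Theory.
Local Open Scope ring_scope.

Section Ideals.
Variable A : comNzRingType.

Definition is_ideal (I : A -> Prop) : Prop :=
  [/\ I 0, (forall a b, I a -> I b -> I (a + b)) & (forall r a, I a -> I (r * a))].

Definition ideal_gen (S : A -> Prop) : A -> Prop :=
  fun x => forall J, is_ideal J -> (forall s, S s -> J s) -> J x.

Definition ideal_add (I J : A -> Prop) : A -> Prop :=
  ideal_gen (fun x => I x \/ J x).

Definition ideal_mul (I J : A -> Prop) : A -> Prop :=
  ideal_gen (fun x => exists a b, [/\ I a, J b & x = a * b]).

Fixpoint ideal_pow (I : A -> Prop) (t : nat) : A -> Prop :=
  match t with
  | 0%N => fun _ => True
  | t'.+1 => ideal_mul (ideal_pow I t') I
  end.

Definition subideal (I J : A -> Prop) : Prop := forall x, I x -> J x.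

Definition is_prime (P : A -> Prop) : Prop :=
  [/\ is_ideal P, ~ P 1 & forall a b, P (a * b) -> P a \/ P b].

Definition minimal_prime (Q P : A -> Prop) : Prop :=
  [/\ is_prime P, subideal Q P &
      forall P', is_prime P' -> subideal Q P' -> subideal P' P -> subideal P P'].

(* Q^(t) = intersection over P in Min(Q) of (Q^t A_P ∩ A);
   f ∈ Q^t A_P ∩ A  iff  s f ∈ Q^t for some s ∉ P. *)
Definition symbolic_power (Q : A -> Prop) (t : nat) : A -> Prop :=
  fun f => forall P, minimal_prime Q P ->
    exists s, ~ P s /\ ideal_pow Q t (s * f).

Definition seq_ideal (fs : seq A) : A -> Prop := ideal_gen (fun x => x \in fs)
  .

Definition regular_seq (M Q : A -> Prop) (fs : seq A) : Prop :=
  [/\ (forall f, f \in fs -> M f),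
      (forall i, (i < size fs)%N -> forall g,
          ideal_add Q (seq_ideal (take i fs)) (nth 0 fs i * g) ->
          ideal_add Q (seq_ideal (take i fs)) g)
    & ~ ideal_add Q (seq_ideal fs) 1].

Definition depth_eq (M Q : A -> Prop) (n : nat) : Prop :=
  (exists fs, size fs = n /\ regular_seq M Q fs) /\
  (forall fs, regular_seq M Q fs -> (size fs <= n)%N).

End Ideals.

Definition is_monomial_ideal (k : fieldType) (n : nat) (K : {mpoly k[n]} -> Prop) : Prop :=
  exists Mon : 'X_{1..n} -> Prop,
    forall f, K f <-> ideal_gen (fun g => exists m, Mon m /\ g = 'X_[m]) f.

Definition max_homog_ideal (k : fieldType) (n : nat) : {mpoly k[n]} -> Prop :=
  ideal_gen (fun g => exists i : 'I_n, g = 'X_i).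

(* Main.v *)
Require Import Defs.
From Stdlib Require Import Classical FunctionalExtensionality PropExtensionality.
From mathcomp Require Import all_boot all_order all_algebra.
From mathcomp Require Import mpoly.
From mathcomp Require Import zify ring.
Local Open Scope ring_scope.
Import Order.TTheory GRing.Theory.
Set Implicit Arguments.
Unset Strict Implicit.
Unset Printing Implicit Defensive.

(* Take K = Q1 ∩ Q2 ∩ Q3 with Q1 = (v^(D-1), u, z^2), Q3 = (x, y, z^2), D = 4m,
   and Q2 generated by monomials in x, v, z.  The facets {x,y}, {y,u}, {u,v}
   complementary to the three primes form a path, so R/K^(t) has depth 1 or 2,
   and depth 1 exactly when some monomial of Q2^t lies in neither Q1^t nor Q3^t.
   Weights (1 for x and v, 2 for z) leave x^(t-1) v^((D-1)t-1) z as the only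
   candidate; it has the least weight Dt occurring in Q2^t, and the generators
   of Q2 of weight D are chosen so that it belongs to Q2^t iff t is not
   congruent to d mod m.
   Lower bounds for the depth come from the sequence x + u, y + v; upper bounds
   from non-trivial Koszul cohomology classes in degrees 1 and 2. *)

(** * Koszul cohomology and regular sequences *)

Section Koszul.
Variables (A : comNzRingType) (n : nat) (X : 'I_n -> A).
Implicit Types (I J : A -> Prop).

Lemma idealB I a b : is_ideal I -> I a -> I b -> I (a - b).
Proof. by case=> _ hD hM ha hb; apply: hD => //; rewrite -mulN1r; apply: hM. Qed.

Lemma ideal_sum I (T : eqType) (r : seq T) (F : T -> A) :
  is_ideal I -> (forall i, i \in r -> I (F i)) -> I (\sum_(i <- r) F i).
Proof.
move=> [h0 hD _] hF; rewrite big_seq; elim/big_rec: _ => // i x ir hx.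
by apply: hD => //; apply: hF.
Qed.

Lemma ideal_gen_ideal (S : A -> Prop) : is_ideal (ideal_gen S).
Proof.
split=> [J [h0 hD hM] _ //|a b ha hb J hJ hS|r a ha J hJ hS].
  by case: (hJ) => _ hD _; apply: hD; [apply: ha|apply: hb].
by case: (hJ) => _ _ hM; apply: hM; apply: ha.
Qed.

Lemma ideal_genS (S : A -> Prop) a : S a -> ideal_gen S a.
Proof. by move=> Sa J _; apply. Qed.

Lemma ideal_addP I J a : is_ideal I -> is_ideal J ->
  ideal_add I J a <-> exists2 j, J j & I (a - j).
Proof.
move=> hI hJ; split=> [h|[j Jj Ij]]; last first.
  rewrite -(subrK j a); case: (ideal_gen_ideal (fun x => I x \/ J x)) => _ hD _.
  by apply: hD; apply: ideal_genS; [left|right].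
have [[i0 iD iM] [j0 jD jM]] := (hI, hJ).
apply: (h (fun a => exists2 j, J j & I (a - j))).
  split=> [|b c [j Jj Ij] [j' Jj' Ij']|r b [j Jj Ij]].
  - by exists 0; rewrite ?subr0.
  - by exists (j + j'); [apply: jD|rewrite opprD addrACA; apply: iD].
  by exists (r * j); [apply: jM|rewrite -mulrBr; apply: iM].
by move=> s [Is|Js]; [exists 0; rewrite ?subr0|exists s; rewrite ?subrr].
Qed.

Lemma seq_ideal_nil (a : A) : seq_ideal [::] a <-> a = 0.
Proof.
split=> [h|->]; last by case: (ideal_gen_ideal (fun x : A => x \in [::])).
apply: (h (fun x => x = 0)) => //; split=> [//|a' b -> ->|r a' ->].
  by rewrite addr0.
by rewrite mulr0.
Qed.

Lemma seq_ideal1 (f a : A) : seq_ideal [:: f] a <-> exists r, a = r * f.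
Proof.
split=> [h|[r ->]].
  apply: (h (fun x => exists r, x = r * f)).
    split=> [|b c [r ->] [s ->]|s b [r ->]]; first by exists 0; rewrite mul0r.
      by exists (r + s); rewrite mulrDl.
    by exists (s * r); rewrite mulrA.
  by move=> s; rewrite inE => /eqP->; exists 1; rewrite mul1r.
case: (ideal_gen_ideal (fun x : A => x \in [:: f])) => _ _; apply.
by apply: ideal_genS; rewrite inE.
Qed.

Definition nzd_mod I f := forall g, I (f * g) -> I g.

Lemma ideal_add_nil I a : is_ideal I -> ideal_add I (seq_ideal [::]) a <-> I a.
Proof.
move=> hI; rewrite ideal_addP //; last exact: ideal_gen_ideal.
split=> [[j /seq_ideal_nil->]|]; first by rewrite subr0.
by exists 0; rewrite ?subr0 //; apply/seq_ideal_nil.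
Qed.

Lemma ideal_add1P I f a : is_ideal I ->
  ideal_add I (seq_ideal [:: f]) a <-> exists r, I (a - f * r).
Proof.
move=> hI; rewrite ideal_addP //; last exact: ideal_gen_ideal.
split=> [[j /seq_ideal1[r ->] h]|[r h]]; first by exists r; rewrite mulrC.
by exists (r * f); [apply/seq_ideal1; exists r|rewrite mulrC].
Qed.

Lemma seq_ideal2 (f g a : A) :
  seq_ideal [:: f; g] a <-> exists r, seq_ideal [:: f] (a - g * r).
Proof.
have idf : is_ideal (seq_ideal [:: f]) := ideal_gen_ideal _.
rewrite -(ideal_add1P g a idf); split=> h J hJ hs.
  apply: h => // s; rewrite !inE => /orP[] /eqP->; apply: hs.
    by left; apply: ideal_genS; rewrite inE.
  by right; apply: ideal_genS; rewrite inE.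
apply: h => // s [] h; apply: h => // s'; rewrite inE => /eqP->; apply: hs;
  by rewrite !inE eqxx ?orbT.
Qed.

Lemma ideal_add2P I f g a : is_ideal I ->
  ideal_add I (seq_ideal [:: f; g]) a <->
  exists r, ideal_add I (seq_ideal [:: f]) (a - g * r).
Proof.
move=> hI; rewrite ideal_addP //; last exact: ideal_gen_ideal.
split=> [[j /seq_ideal2[r h] hj]|[r /(ideal_add1P _ _ hI)[s h]]].
  exists r; rewrite ideal_addP //; last exact: ideal_gen_ideal.
  by exists (j - g * r); rewrite // opprB addrA subrK.
exists (g * r + f * s); last by rewrite opprD addrA.
apply/seq_ideal2; exists r; rewrite addrC addKr.
by apply/seq_ideal1; exists s; rewrite mulrC.
Qed.

(* Exactness of the Koszul cochain complex of [X] with coefficients in [A/J]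
   in degrees 0, 1, 2; nothing is lost by letting cochains be arbitrary rather
   than alternating. *)
Definition koszul0 J := forall c, (forall i, J (X i * c)) -> J c.
Definition koszul1 J := forall c : 'I_n -> A,
  (forall i j, J (X i * c j - X j * c i)) ->
  exists e, forall j, J (c j - X j * e).
Definition koszul2 J := forall c : 'I_n -> 'I_n -> A,
  (forall i j l, J (X i * c j l - X j * c i l + X l * c i j)) ->
  exists b, forall i j, J (c i j - (X i * b j - X j * b i)).

Section Step.
Variables (J J' : A -> Prop) (f : A) (h : 'I_n -> A).
Hypotheses (idJ : is_ideal J) (fE : f = \sum_i h i * X i) (nzf : nzd_mod J f).
Hypothesis J'P : forall a, J' a <-> exists r, J (a - f * r).

(** An element sent into [J] by every [X i] is sent there by their combination [f], which
    cancels. *)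
Lemma koszul0_nzd : koszul0 J.
Proof.
move=> c hc; apply: nzf; rewrite fE mulr_suml; apply: ideal_sum => // i _.
by rewrite -mulrA; case: idJ => _ _; apply.
Qed.

(* Contracting a cocycle with [h] multiplies it by [f] up to a coboundary, so
   its contraction is a cocycle modulo [f] of one degree less. *)
Lemma koszul1_nzd : koszul0 J' -> koszul1 J.
Proof.
move=> K c hc; have [_ hD hM] := idJ.
pose b := \sum_i h i * c i.
have hb j : J (X j * b - f * c j).
  rewrite fE mulr_sumr mulr_suml -sumrB; apply: ideal_sum => // i _.
  have -> : X j * (h i * c i) - h i * X i * c j = h i * (X j * c i - X i * c j).
    by ring.
  exact: hM.
have /J'P[e he] : J' b by apply: K => j; apply/J'P; exists (c j); apply: hb.
exists e => j; apply: nzf.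
have -> : f * (c j - X j * e) = X j * (b - f * e) - (X j * b - f * c j) by ring.
by apply: idealB => //; apply: hM.
Qed.

Lemma koszul2_nzd : koszul1 J' -> koszul2 J.
Proof.
move=> K c hc; have [_ hD hM] := idJ.
pose b j := \sum_l h l * c l j.
have hb i j : J (X i * b j - X j * b i - f * c i j).
  rewrite fE !mulr_sumr mulr_suml -!sumrB; apply: ideal_sum => // l _.
  have -> : X i * (h l * c l j) - X j * (h l * c l i) - h l * X l * c i j =
      - h l * (X l * c i j - X i * c l j + X j * c l i) by ring.
  exact: hM.
have [e he] : exists e, forall j, J' (b j - X j * e).
  by apply: K => i j; apply/J'P; exists (c i j); apply: hb.
have /fin_all_exists[g hg] j : exists r, J (b j - X j * e - f * r) by apply/J'P.
exists g => i j; apply: nzf.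
have -> : f * (c i j - (X i * g j - X j * g i)) =
    X i * (b j - X j * e - f * g j) - X j * (b i - X i * e - f * g i)
    - (X i * b j - X j * b i - f * c i j) by ring.
by apply: idealB => //; apply: idealB => //; apply: hM.
Qed.

End Step.

Definition var_ideal : A -> Prop := ideal_gen (fun g => exists i, g = X i).

Lemma var_idealP f : var_ideal f -> exists h : 'I_n -> A, f = \sum_i h i * X i.
Proof.
move=> hf; apply: (hf (fun f => exists h : 'I_n -> A, f = \sum_i h i * X i)); last first.
  move=> _ [i ->]; exists (fun j => (j == i)%:R).
  rewrite (bigD1 i) //= eqxx mul1r big1 ?addr0 // => j /negPf->.
  by rewrite mul0r.
split=> [|a b [h ->] [g ->]|r a [h ->]].
- by exists (fun=> 0); rewrite big1 // => i _; rewrite mul0r.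
- by exists (fun i => h i + g i); rewrite -big_split; apply: eq_bigr => i _; rewrite mulrDl.
by exists (fun i => r * h i); rewrite mulr_sumr; apply: eq_bigr => i _; rewrite mulrA.
Qed.

(** The second element gives exactness in degree 0 modulo the first, and the first raises the degree
    by one. *)
Lemma regular_koszul1 J f g fs : is_ideal J ->
  regular_seq var_ideal J [:: f, g & fs] -> koszul1 J.
Proof.
move=> idJ [hM hr _].
have [hf Ef] := var_idealP (hM f (mem_head _ _)).
have [hg Eg] : exists h, g = \sum_i h i * X i.
  by apply: var_idealP; apply: hM; rewrite !inE eqxx orbT.
apply: (koszul1_nzd idJ Ef _ (fun a => ideal_add1P f a idJ)).
  by move=> a /(ideal_add_nil _ idJ)/(hr 0%N isT)/(ideal_add_nil _ idJ).
apply: (koszul0_nzd (ideal_gen_ideal _) Eg).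
by move=> a; apply: (hr 1%N).
Qed.

(** The same descent with three elements: degree 0 modulo [f, g], then degree 1 modulo [f], then
    degree 2. *)
Lemma regular_koszul2 J f g l fs : is_ideal J ->
  regular_seq var_ideal J [:: f, g, l & fs] -> koszul2 J.
Proof.
move=> idJ [hM hr _].
have [hf Ef] := var_idealP (hM f (mem_head _ _)).
have [hg Eg] : exists h, g = \sum_i h i * X i.
  by apply: var_idealP; apply: hM; rewrite !inE eqxx orbT.
have [hl El] : exists h, l = \sum_i h i * X i.
  by apply: var_idealP; apply: hM; rewrite !inE eqxx !orbT.
apply: (koszul2_nzd idJ Ef _ (fun a => ideal_add1P f a idJ)).
  by move=> a /(ideal_add_nil _ idJ)/(hr 0%N isT)/(ideal_add_nil _ idJ).
apply: (koszul1_nzd (ideal_gen_ideal _) Eg _ (fun a => ideal_add2P f g a idJ)).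
  by move=> a; apply: (hr 1%N).
apply: (koszul0_nzd (ideal_gen_ideal _) El).
by move=> a; apply: (hr 2%N).
Qed.

End Koszul.

(** * Monomial ideals *)

Lemma seq_max d (T : orderType d) (s : seq T) x : x \in s ->
  exists2 y, y \in s & forall z, z \in s -> (z <= y)%O.
Proof.
elim: s x => // a [|b s] IH x _; first by exists a => [|z]; rewrite inE // => /eqP->.
have [y ys hy] := IH b (mem_head _ _).
case: (leP a y) => ay.
  exists y => [|z]; rewrite inE ?ys ?orbT // => /orP[/eqP->//|]; exact: hy.
exists a => [|z]; rewrite inE ?eqxx // => /orP[/eqP->//|/hy zy].
exact: le_trans zy (ltW ay).
Qed.

Section MonomialIdeals.
Variables (k : fieldType) (n : nat).
Local Notation mon := 'X_{1..n}.
Local Notation R := {mpoly k[n]}.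
Implicit Types (f g : R) (a b c : mon) (S : pred 'I_n) (U V : mon -> Prop).

(** A polynomial lies in a monomial ideal iff all its monomials do, so the ideal is encoded by its
    exponent set. For arbitrary [U] this is only a subspace. *)
Definition mon_ideal U f := forall a, a \in msupp f -> U a.

(* [U] is closed under multiplication and involves only the variables in [S]. *)
Definition upward S U :=
  forall a b, (forall i, S i -> (a i <= b i)%N) -> U a -> U b.

Lemma upwardW S U : upward S U -> upward predT U.
Proof. by move=> h a b ab; apply: h => i _; apply: ab. Qed.

Lemma mon_ideal_ideal U : upward predT U -> is_ideal (mon_ideal U).
Proof.
move=> hU; split=> [a|f g hf hg a /msuppD_le|f g hg c /msuppM_le].
- by rewrite msupp0.
- by rewrite mem_cat => /orP[/hf|/hg].
case/allpairsP => -[a b] /= [_ /hg Ub ->]; apply: hU Ub => i _.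
by rewrite mnmDE leq_addl.
Qed.

Lemma mon_idealX U a : mon_ideal U 'X_[a] <-> U a.
Proof.
by split=> [|Ua b]; [apply; rewrite msuppX inE|rewrite msuppX inE => /eqP->].
Qed.

Lemma mon_ideal_coef U f a : mon_ideal U f -> ~ U a -> f@_a = 0.
Proof. by move=> hf nU; apply: memN_msupp_eq0; apply/negP => /hf. Qed.

Lemma mon_ideal_sub U V f : (forall a, U a -> V a) -> mon_ideal U f -> mon_ideal V f.
Proof. by move=> UV hf a /hf/UV. Qed.

Lemma mon_idealI U V f :
  mon_ideal (fun a => U a /\ V a) f <-> mon_ideal U f /\ mon_ideal V f.
Proof.
split=> [h|[hU hV] a ha]; last by split; [apply: hU|apply: hV].
by split=> a /h[].
Qed.

Lemma mon_ideal_ind U (P : R -> Prop) f :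
  P 0 -> (forall p q, P p -> P q -> P (p + q)) ->
  (forall (x : k) a, U a -> P (x *: 'X_[a])) -> mon_ideal U f -> P f.
Proof.
move=> P0 PD PX hf; rewrite (mpolyE f) big_seq; elim/big_ind: _ => // a /hf.
exact: PX.
Qed.

Lemma mon_ideal_gen U J f : is_ideal J -> (forall a, U a -> J 'X_[a]) ->
  mon_ideal U f -> J f.
Proof.
case=> J0 JD JM JX; apply: mon_ideal_ind => // c a /JX.
by rewrite -mul_mpolyC; apply: JM.
Qed.

(** Each term goes to one side: a union of exponent sets encodes a sum of ideals. This serves to
    glue solutions found on different components. *)
Lemma mon_ideal_split U V f : mon_ideal (fun a => U a \/ V a) f ->
  exists p q, [/\ mon_ideal U p, mon_ideal V q & f = p + q].
Proof.
have h0 W : mon_ideal W 0 by move=> a; rewrite msupp0.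
have hZ (W : mon -> Prop) x a : W a -> mon_ideal W (x *: 'X_[a]).
  by move=> Wa b /msuppZ_le; rewrite msuppX inE => /eqP->.
have hD W p q : mon_ideal W p -> mon_ideal W q -> mon_ideal W (p + q).
  by move=> hp hq a /msuppD_le; rewrite mem_cat => /orP[/hp|/hq].
apply: (mon_ideal_ind (P := fun f => exists p q, _)) => [|p q|x a].
- by exists 0, 0; split=> //; rewrite addr0.
- move=> [p1 [q1 [hp1 hq1 ->]]] [p2 [q2 [hp2 hq2 ->]]].
  by exists (p1 + p2), (q1 + q2); split; [apply: hD|apply: hD|rewrite addrACA].
by case=> /hZ h; [exists (x *: 'X_[a]), 0|exists 0, (x *: 'X_[a])];
  split; rewrite // ?addr0 ?add0r.
Qed.

Lemma mon_ideal_monomial U : upward predT U -> is_monomial_ideal (mon_ideal U).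
Proof.
move=> hU; exists U => f; split.
  apply: mon_ideal_gen; first exact: ideal_gen_ideal.
  by move=> a Ua; apply: ideal_genS; exists a.
apply; first exact: mon_ideal_ideal.
by move=> _ [a [Ua ->]]; apply/mon_idealX.
Qed.

(** A single pair of terms contributes to this coefficient, so nothing cancels. *)
Lemma mcoeffM_uniq f g a b : a \in msupp f -> b \in msupp g ->
  (forall a' b', a' \in msupp f -> b' \in msupp g ->
     (a' + b')%MM = (a + b)%MM -> a' = a /\ b' = b) ->
  (f * g)@_(a + b) = f@_a * g@_b.
Proof.
move=> fa gb huniq; rewrite mpolyME raddf_sum big_allpairs /=.
rewrite (bigD1_seq a) //= (bigD1_seq b) //= mcoeffZ mcoeffX eqxx mulr1.
rewrite big1_seq => [|b' /andP[nb hb]]; last first.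
  rewrite mcoeffZ mcoeffX; case: eqP => [/(huniq _ _ fa hb)[_ bE]|]; last by rewrite mulr0.
  by rewrite bE eqxx in nb.
rewrite addr0 big1_seq ?addr0 // => a' /andP[na ha]; rewrite big1_seq // => b' /andP[_ hb].
rewrite mcoeffZ mcoeffX; case: eqP => [/(huniq _ _ ha hb)[aE _]|]; last by rewrite mulr0.
by rewrite aE eqxx in na.
Qed.

(* Pick in [g] a term outside [U], first of least degree in the variables of
   [S], then largest in the monomial order; multiplied by the largest term of
   [f] free of the variables of [S] it cannot be cancelled in [f * g]. *)
Lemma mon_ideal_nzd S U f a0 : upward S U ->
  a0 \in msupp f -> (forall i, S i -> a0 i = 0%N) -> nzd_mod (mon_ideal U) f.
Proof.
move=> hU fa0 Sa0 g hfg b0 gb0; apply: NNPP => nb0.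
pose deg a := (\sum_(i | S i) a i)%N.
have degD a b : deg (a + b)%MM = (deg a + deg b)%N.
  by rewrite /deg -big_split; apply: eq_bigr => i _; rewrite mnmDE.
have [N [b1 [gb1 nb1 EN]] Nmin] : exists2 N, (exists b, [/\ b \in msupp g, ~ U b & deg b = N]) &
    forall b, b \in msupp g -> ~ U b -> (N <= deg b)%N.
  have [N leN] := ubnP (deg b0).
  elim: N b0 gb0 nb0 leN => // N IH b gb nb leN.
  case: (classic (exists b', [/\ b' \in msupp g, ~ U b' & deg b' < deg b]%N)).
    by move=> [b' [? ? lt]]; apply: (IH b') => //; exact: leq_trans lt _.
  move=> nex; exists (deg b); first by exists b.
  by move=> b' ? ?; rewrite leqNgt; apply/negP => ?; apply: nex; exists b'.
pose agree (a b : mon) := [forall i, S i ==> (a i == b i)].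
have agreeP a b : reflect (forall i, S i -> a i = b i) (agree a b).
  apply: (iffP forallP) => [h i Si|h i]; first by apply/eqP/(implyP (h i)).
  by apply/implyP => /h/eqP.
have degE b : (forall i, S i -> b i <= b1 i)%N -> (N <= deg b)%N -> agree b b1.
  move=> le leN; apply/agreeP => i Si; apply/eqP; rewrite eqn_leq le //= leqNgt.
  apply/negP => lt; move: leN; rewrite -EN /deg (bigD1 i) //= [leqRHS](bigD1 i) //=.
  apply/negP; rewrite -ltnNge -addSn leq_add //.
  by apply: leq_sum => j /andP[/le].
have a0in : a0 \in [seq a <- msupp f | agree a 0%MM].
  by rewrite mem_filter fa0 andbT; apply/agreeP => i /Sa0->; rewrite mnm0E.
have [a] := seq_max a0in; rewrite mem_filter => /andP[/agreeP aS fa] amax.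
have b1in : b1 \in [seq b <- msupp g | agree b b1].
  by rewrite mem_filter gb1 andbT; apply/agreeP.
have [b] := seq_max b1in; rewrite mem_filter => /andP[/agreeP bS gb] bmax.
have nUb : ~ U b by move=> Ub; apply: nb1; apply: hU Ub => i /bS->.
suff : (f * g)@_(a + b) != 0.
  rewrite -mcoeff_msupp => /hfg Uab; apply: nUb; apply: hU Uab => i Si.
  by rewrite mnmDE aS // mnm0E.
rewrite mcoeffM_uniq //; first by rewrite mulf_neq0 // -mcoeff_msupp.
move=> a' b' fa' gb' E.
have Ei i : (a' i + b' i = a i + b i)%N by rewrite -!mnmDE E.
have EiS i : S i -> (a' i + b' i = b i)%N by move=> Si; rewrite Ei aS // mnm0E.
(* On [S], [b'] is at most [b], so it is outside [U] as well, and minimality of the degree forces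
   equality on [S]. *)
have b'1 : agree b' b1.
  apply: degE => [i Si|]; first by rewrite -bS // -EiS // leq_addl.
  apply: Nmin => // Ub'; apply: nUb; apply: hU Ub' => i Si.
  by rewrite -EiS // leq_addl.
have a'0 : agree a' 0%MM.
  apply/agreeP => i Si; apply/eqP; rewrite mnm0E -(eqn_add2r (b' i)) EiS //.
  by rewrite (agreeP _ _ b'1 i Si) bS.
have leb : (b' <= b)%O by apply: bmax; rewrite mem_filter b'1.
have lea : (a' <= a)%O by apply: amax; rewrite mem_filter a'0.
(* Neither factor exceeds the chosen maximum while the products agree, so both inequalities are
   equalities. *)
have ab : a' = a.
  apply/eqP; rewrite eq_le lea leNgt; apply/negP => lt.
  by have := ltmc_le_add lt leb; rewrite E ltxx.
by split=> //; apply/eqP; rewrite -(eqm_add2l a) -{1}ab E.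
Qed.

End MonomialIdeals.

(** * Symbolic powers of monomial ideals *)

Section MonomialPowers.
Variables (k : fieldType) (n : nat).
Local Notation mon := 'X_{1..n}.
Local Notation R := {mpoly k[n]}.
Implicit Types (f g : R) (a b c : mon) (S : pred 'I_n) (U V : mon -> Prop).

Fixpoint mon_pow U t : mon -> Prop :=
  match t with
  | 0%N => fun=> True
  | t'.+1 => fun a => exists b c, [/\ mon_pow U t' b, U c & a = (b + c)%MM]
  end.

Lemma upward_mon_pow S U t : upward S U -> upward S (mon_pow U t).
Proof.
move=> hU; elim: t => [//|t IH] a a' le [b [c [Ub Uc aE]]].
(* Coordinates off [S] are unconstrained, so the last factor absorbs all of [a'] there. *)
pose c' := [multinom (if S i then c i else a' i) | i < n].
have hle i : S i -> (b i + c i <= a' i)%N by move=> /le; rewrite aE mnmDE.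
exists (a' - c')%MM, c'; split.
- by apply: IH Ub => i Si; rewrite mnmBE mnmE Si; have := hle i Si; lia.
- by apply: hU Uc => i Si; rewrite mnmE Si.
apply/mnmP => i; rewrite mnmDE mnmBE mnmE; case: ifP => [/hle|_]; lia.
Qed.

Lemma ideal_pow_ideal (K : R -> Prop) t : is_ideal (ideal_pow K t).
Proof. by case: t => [//|t]; apply: ideal_gen_ideal. Qed.

Lemma ideal_pow_mon U (K : R -> Prop) t f : upward predT U ->
  (forall g, K g -> mon_ideal U g) ->
  ideal_pow K t f -> mon_ideal (mon_pow U t) f.
Proof.
move=> hU KU; elim: t f => [//|t IH] f; apply.
  by apply: mon_ideal_ideal; apply: upward_mon_pow.
move=> _ [g [h [/IH hg /KU hh ->]]] a /msuppM_le/allpairsP[[b c] /= [gb hc ->]].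
by exists b, c; split; [apply: hg|apply: hh|].
Qed.

(** Each of the [t] factors receives one copy of [e]. With [e] outside a prime, this witnesses
    membership in the localized power. *)
Lemma mon_pow_ideal_pow U (K : R -> Prop) e t a :
  (forall b, U b -> K 'X_[e + b]) -> mon_pow U t a ->
  ideal_pow K t 'X_[e *+ t + a].
Proof.
move=> hK; elim: t a => [//|t IH] a [b [c [/IH hb /hK hc ->]]].
apply: ideal_genS; exists 'X_[e *+ t + b], 'X_[e + c]; split=> //.
rewrite -mpolyXD; congr 'X_[_]; apply/mnmP => i.
by rewrite !mnmDE !mulmnE mulnS; lia.
Qed.

(** * Primes generated by variables *)

Definition var_prime S := mon_ideal (k := k) (fun a => exists2 i, S i & (0 < a i)%N).

Lemma var_prime_upward S : upward S (fun a => exists2 i, S i & (0 < a i)%N).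
Proof. by move=> a b le [i Si ai]; exists i => //; apply: leq_trans ai (le i Si). Qed.

Lemma var_primePn S f : ~ var_prime S f ->
  exists2 a, a \in msupp f & forall i, S i -> a i = 0%N.
Proof.
move=> nf; apply: NNPP => nex; apply: nf => a fa; apply: NNPP => na.
apply: nex; exists a => // i Si; apply/eqP; rewrite -leqn0 leqNgt.
by apply/negP => ai; apply: na; exists i.
Qed.

(** The associated primes of an ideal generated by monomials in the variables of [S] lie inside the
    prime of these variables. *)
Lemma mon_ideal_nzd_prime S U f : upward S U -> ~ var_prime S f ->
  nzd_mod (mon_ideal U) f.
Proof. by move=> hU /var_primePn[a fa Sa]; apply: mon_ideal_nzd fa Sa. Qed.

Lemma var_primeX S i : var_prime S 'X_i <-> S i.
Proof.
rewrite /var_prime mon_idealX; split=> [[j Sj]|Si].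
  by rewrite mnm1E; case: eqP => // ->.
by exists i; rewrite // mnm1E eqxx.
Qed.

(** Primality is the cancellation property above, applied to this ideal itself. *)
Lemma var_prime_prime S : is_prime (var_prime S).
Proof.
have up := @var_prime_upward S; split=> [||f g fg].
- exact: mon_ideal_ideal (upwardW up).
- by move=> h; have [|i _] := h 0%MM; rewrite ?msupp1 ?inE // mnm0E.
case: (classic (var_prime S f)) => [|nf]; first by left.
by right; apply: mon_ideal_nzd_prime nf _ fg.
Qed.

Lemma prime_exp (P : R -> Prop) f m : is_prime P -> P (f ^+ m) -> P f.
Proof.
case=> _ P1 PM; elim: m => [|m IH]; first by rewrite expr0 => /P1.
by rewrite exprS => /PM[].
Qed.

(** * Minimal primes and symbolic powers of an intersection of primary monomial ideals *)

Section Symbolic.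
Variables (I : finType) (S : I -> pred 'I_n) (U : I -> mon -> Prop).
(** The hypotheses make [U i] primary to the prime of the variables in [S i]. The monomial [e i]
    avoids that prime and lies in all other components, so inverting it isolates [U i]. *)
Variables (e : I -> mon) (N : nat).
Hypothesis upU : forall i, upward (S i) (U i).
Hypothesis UN : forall i j, S i j -> U i (U_(j) *+ N)%MM.
Hypothesis eS : forall i j, S i j -> e i j = 0%N.
Hypothesis eU : forall i l, l != i -> U l (e i).
Hypothesis U0 : forall i, ~ U i 0%MM.
Let K := mon_ideal (k := k) (fun a => forall i, U i a).

Lemma sub_var_prime i : subideal K (var_prime (S i)).
Proof.
move=> f hf a /hf/(_ i) Ua; apply: NNPP => na; apply: (@U0 i).
apply: upU Ua => j Sj; rewrite mnm0E leqNgt; apply/negP => aj.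
by apply: na; exists j.
Qed.

(** Otherwise every [S i] has a variable outside [P]; the product of their [N]-th powers lies in
    [K], hence in [P], and primality gives a contradiction. *)
Lemma prime_contains_var_prime P : is_prime P -> subideal K P ->
  exists i, subideal (var_prime (S i)) P.
Proof.
move=> prP KP; have [idP P1 PM] := prP; apply: NNPP => nex.
have /fin_all_exists[j hj] i : exists j, S i j /\ ~ P 'X_j.
  apply: NNPP => ne; apply: nex; exists i => f; apply: mon_ideal_gen => // a [j Sj aj].
  have Pj : P 'X_j by apply: NNPP => nP; apply: ne; exists j.
  have -> : a = (a - U_(j) + U_(j))%MM by rewrite submK // lep1mP -lt0n.
  by rewrite mpolyXD; case: idP => _ _; apply.
have: P 'X_[\sum_i U_(j i) *+ N].
  apply: KP; apply/mon_idealX => i; have [Sj _] := hj i.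
  apply: upU (UN Sj) => l _; rewrite mnm_sumE (bigD1 i) //=; exact: leq_addr.
rewrite -mprodXE; elim/big_rec: _ => // i f _ IH /PM[]//.
by rewrite -mpolyXn => /(prime_exp prP); case: (hj i).
Qed.

(** If [S l] were contained in [S i] with [l != i], then [e i], a member of [U l], would be free of
    the variables of [S l], and [U l] would contain 1. *)
Lemma var_prime_antichain i l :
  subideal (var_prime (S l)) (var_prime (S i)) -> l = i.
Proof.
move=> sub; apply/eqP; apply: contraT => /eU Ue; case: (@U0 l).
apply: upU Ue => j /var_primeX/sub/var_primeX /eS->.
by rewrite mnm0E.
Qed.

Lemma minimal_primeP P :
  minimal_prime K P <-> exists i, forall f, P f <-> var_prime (S i) f.
Proof.
split=> [[prP KP Pmin]|[i Pi]].
  have [i sub] := prime_contains_var_prime prP KP; exists i => f; split; last exact: sub.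
  by apply: Pmin => //; [apply: var_prime_prime|apply: sub_var_prime].
have [[h0 hD hM] h1 hP] := var_prime_prime (S i).
split.
- split=> [||f g]; rewrite ?Pi //; last exact: hP.
  by split=> [|f g|f g]; rewrite !Pi //; [apply: hD|apply: hM].
- by move=> f /sub_var_prime; rewrite Pi.
move=> P' prP' KP' sub f /Pi; have [l subl] := prime_contains_var_prime prP' KP'.
rewrite -(@var_prime_antichain i l); first exact: subl.
by move=> g /subl/sub/Pi.
Qed.

Lemma symbolic_power_mon t f : symbolic_power K t f <->
  mon_ideal (fun a => forall i, mon_pow (U i) t a) f.
Proof.
split=> [h a fa i|hf P /minimal_primeP[i Pi]].
  have [|s [ns hs]] := h (var_prime (S i)); first by apply/minimal_primeP; exists i.
  (* The multiplier [s] is outside the prime, hence cancels modulo the [t]-th power of the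
     component. *)
  refine (mon_ideal_nzd_prime (upward_mon_pow (@upU i)) ns _ fa).
  apply: ideal_pow_mon hs; first exact: upwardW (@upU i).
  by move=> g hg b /hg.
exists 'X_[e i *+ t]; split.
  by rewrite Pi /var_prime mon_idealX => -[j /eS ej]; rewrite mulmnE ej.
have [_ _ hM] := ideal_pow_ideal K t.
move: hf; apply: (mon_ideal_ind (P := fun f => ideal_pow K t ('X_[e i *+ t] * f))) => [|p q|x a /(_ i) ha].
- by rewrite mulr0; case: (ideal_pow_ideal K t).
- by rewrite mulrDr; case: (ideal_pow_ideal K t) => _ hD _; apply: hD.
rewrite -scalerAr -mpolyXD -mul_mpolyC; apply: hM.
apply: mon_pow_ideal_pow ha => b Ub; apply/mon_idealX => l.
case: (eqVneq l i) => [->|/eU].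
  by apply: upU Ub => j _; rewrite mnmDE leq_addl.
by apply: upU => j _; rewrite mnmDE leq_addr.
Qed.

End Symbolic.

(* The substitution [X_i := - X_j] kills [X_i + X_j] and preserves every
   monomial ideal not involving [X_i]. *)
Definition subst_neg (i j : 'I_n) f : R :=
  f \mPo [tuple (if l == i then - 'X_j else 'X_l) | l < n].

Lemma subst_neg_modE i j f : exists q, f = subst_neg i j f + ('X_i + 'X_j) * q.
Proof.
(* The congruence is multiplicative, which reduces monomials to single variables. *)
have hM p q : (exists r, p = subst_neg i j p + ('X_i + 'X_j) * r) ->
    (exists r, q = subst_neg i j q + ('X_i + 'X_j) * r) ->
    exists r, p * q = subst_neg i j (p * q) + ('X_i + 'X_j) * r.
  rewrite /subst_neg rmorphM /=; move=> [r Er] [s Es].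
  exists (r * q + (p \mPo [tuple (if l == i then - 'X_j else 'X_l) | l < n]) * s).
  rewrite {1}Er {1}Es; set p' := p \mPo _; set q' := q \mPo _.
  rewrite [in RHS]Es -/q'; ring.
elim/mpolyind: f => [|x a p _ _ [r Er]].
  by exists 0; rewrite /subst_neg raddf0 mulr0 addr0.
have [s Es] : exists s, 'X_[a] = subst_neg i j 'X_[a] + ('X_i + 'X_j) * s.
  rewrite ['X_[a]]mpolyXE_id.
  elim/big_ind: _ => [||l _]; first by exists 0; rewrite /subst_neg rmorph1 mulr0 addr0.
    exact: hM.
  elim: (a l) => [|m IH]; first by exists 0; rewrite expr0 /subst_neg rmorph1 mulr0 addr0.
  rewrite exprS; apply: hM IH; rewrite /subst_neg comp_mpolyXU -tnth_nth tnth_mktuple.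
  case: eqP => [->|_]; last by exists 0; rewrite mulr0 addr0.
  by exists 1; rewrite mulr1 addrC addrK.
exists (x *: s + r); rewrite {1}Er {1}Es /subst_neg rmorphD /= comp_mpolyZ.
by rewrite scalerDr scalerAr mulrDr addrACA.
Qed.

Lemma subst_neg_mon U i j f : upward (predC1 i) U ->
  mon_ideal U f -> mon_ideal U (subst_neg i j f).
Proof.
move=> hU; have [h0 hD hM] := mon_ideal_ideal k (upwardW hU).
apply: (mon_ideal_ind (P := fun f => mon_ideal U (subst_neg i j f))) => [|p q hp hq|x a Ua].
- by rewrite /subst_neg raddf0.
- by rewrite /subst_neg raddfD; apply: hD.
rewrite /subst_neg comp_mpolyZ -mul_mpolyC; apply: (hM).
(* Dropping [X_i] keeps the exponent in [U]; the remaining variables are fixed by the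
   substitution. *)
pose a' := [multinom (if l == i then 0 else a l) | l < n].
have -> : a = (U_(i) *+ a i + a')%MM.
  apply/mnmP => l; rewrite mnmDE mulmnE mnm1E mnmE eq_sym.
  by case: eqP => [->|_]; rewrite ?mul1n ?addn0.
rewrite mpolyXD rmorphM /=; apply: hM.
rewrite comp_mpolyX [X in mon_ideal _ X](_ : _ = 'X_[a']).
  by apply/mon_idealX; apply: hU Ua => l; rewrite mnmE /= => /negPf->.
rewrite [RHS]mpolyXE_id; apply: eq_bigr => l _; rewrite tnth_mktuple mnmE.
by case: eqP => // _; rewrite !expr0.
Qed.

End MonomialPowers.

(** * Depth for three components along a path *)

(* The three components involve the variables outside [{x, y}], [{y, u}] and
   [{u, v}] respectively. *)
Section Path.
Variables (k : fieldType) (n : nat) (x y u v : 'I_n).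
Hypothesis xyuv : uniq [:: x; y; u; v].
Local Notation mon := 'X_{1..n}.
Local Notation R := {mpoly k[n]}.
Local Notation mI := (@mon_ideal k n).
Local Notation M := (@max_homog_ideal k n).
Implicit Types (f g : R) (a b c : mon) (S : pred 'I_n) (U : mon -> Prop).

Definition off (p q : 'I_n) : pred 'I_n := fun i => (i != p) && (i != q).

Lemma var_primeD S p q : p != q -> ~~ S p -> ~ var_prime (k := k) S ('X_p + 'X_q).
Proof.
move=> pq Sp /mon_ideal_coef hc; have := hc (U_(p)%MM : mon).
rewrite mcoeffD !mcoeffXU eqxx eq_sym (negPf pq) addr0 => h.
suff /h/eqP : ~ exists2 i, S i & (0 < U_(p)%MM i)%N by rewrite oner_eq0.
by move=> [i Si]; rewrite mnm1E; case: eqP => // pi; rewrite pi Si in Sp.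
Qed.

Lemma nzdD S U p q : upward S U -> p != q -> ~~ S p ->
  nzd_mod (mI U) ('X_p + 'X_q).
Proof. by move=> hU pq Sp; apply: mon_ideal_nzd_prime hU _; apply: var_primeD. Qed.

Variables UA UC UB : mon -> Prop.
Hypotheses (upA : upward (off x y) UA) (upC : upward (off y u) UC).
Hypotheses (upB : upward (off u v) UB).
Let J := mI (fun a => [/\ UA a, UC a & UB a]).
Let A := mI UA.
Let B := mI UB.
Let C := mI UC.

Lemma path_idealP f : J f <-> [/\ A f, C f & B f].
Proof.
split=> [h|[hA hC hB] a fa]; last by split; [apply: hA|apply: hC|apply: hB].
by split=> a /h[].
Qed.

Let idA : is_ideal A. Proof. exact: mon_ideal_ideal (upwardW upA). Qed.
Let idB : is_ideal B. Proof. exact: mon_ideal_ideal (upwardW upB). Qed.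
Let idC : is_ideal C. Proof. exact: mon_ideal_ideal (upwardW upC). Qed.
Let idJ : is_ideal J.
Proof.
apply: mon_ideal_ideal => a b ab [hA hC hB].
by split; [apply: upA hA|apply: upC hC|apply: upB hB] => i _; apply: ab.
Qed.

Let neqs : [/\ x != y, x != u, y != u & u != v] /\ (x != v) && (y != v).
Proof.
by move: xyuv; rewrite /= !inE !negb_or => /and4P[/and3P[-> -> ->] /andP[-> ->] ->].
Qed.

Lemma max_homog_idealX i : M 'X_i.
Proof. by apply: ideal_genS; exists i. Qed.

Lemma max_homog_idealD i j : M ('X_i + 'X_j).
Proof.
have [_ hD _] := ideal_gen_ideal (fun g : R => exists i : 'I_n, g = 'X_i).
by apply: hD; apply: max_homog_idealX.
Qed.

Lemma path_proper fs : ~ UC 0%MM -> (forall f, f \in fs -> M f) ->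
  ~ ideal_add J (seq_ideal fs) 1.
Proof.
move=> C0 hM h; have [idP P1 _] := var_prime_prime k (@predT 'I_n).
apply: P1; apply: h => // f [/path_idealP[_ hC _] a /hC Ua|hs].
  apply: NNPP => na; apply: C0; apply: upC Ua => i _.
  by rewrite mnm0E leqNgt; apply/negP => ai; apply: na; exists i.
apply: hs => // g /hM hg; apply: hg => // _ [i ->].
exact/var_primeX.
Qed.

(** Each component omits [x] or [u], so the sum cancels modulo each of them separately. *)
Lemma path_theta1_nzd : nzd_mod J ('X_x + 'X_u).
Proof.
have [[xy xu yu uv] _] := neqs.
move=> g /path_idealP[hA hC hB]; apply/path_idealP; split.
- by apply: nzdD upA xu _ _ hA; rewrite /off eqxx.
- by rewrite addrC in hC; apply: nzdD upC _ _ _ hC; rewrite /off ?eqxx ?andbF // eq_sym.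
by rewrite addrC in hB; apply: nzdD upB _ _ _ hB; rewrite /off ?eqxx // eq_sym.
Qed.

Lemma path_regular1 : ~ UC 0%MM -> regular_seq M J [:: 'X_x + 'X_u].
Proof.
move=> C0; have hM f : f \in [:: 'X_x + 'X_u] -> M f.
  by rewrite inE => /eqP->; apply: max_homog_idealD.
split=> //; last exact: path_proper.
case=> //= _ g /(ideal_add_nil _ idJ)/path_theta1_nzd ?; exact/(ideal_add_nil _ idJ).
Qed.

(* Over one component [x + u, y + v] is regular: substituting away a variable
   absent from the component reduces to [y + v] alone. *)
Lemma component_regular U i j (g r : R) :
  upward (predC1 i) U -> i != j -> i != y -> i != v ->
  nzd_mod (mI U) ('X_i + 'X_j) -> nzd_mod (mI U) ('X_y + 'X_v) ->
  mI U (('X_y + 'X_v) * g - ('X_i + 'X_j) * r) ->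
  exists e, mI U (g - ('X_i + 'X_j) * e) /\
            mI U (r - ('X_y + 'X_v) * e).
Proof.
move=> hU ij iy iv nz1 nz2 h; have idU := mon_ideal_ideal k (upwardW hU).
have [q Eq] := subst_neg_modE i j g.
have hX l : l != i -> subst_neg i j ('X_l : R) = 'X_l.
  by move=> /negPf li; rewrite /subst_neg comp_mpolyXU -tnth_nth tnth_mktuple li.
have hi : subst_neg i j ('X_i : R) = - 'X_j.
  by rewrite /subst_neg comp_mpolyXU -tnth_nth tnth_mktuple eqxx.
have hj : subst_neg i j ('X_i + 'X_j : R) * subst_neg i j r = 0.
  rewrite /subst_neg rmorphD /= -/(subst_neg i j _) hi.
  by rewrite -/(subst_neg i j _) hX 1?eq_sym // addNr mul0r.
exists q; suff hg : mI U (g - ('X_i + 'X_j) * q).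
  split=> //; apply: nz1.
  have -> : ('X_i + 'X_j) * (r - ('X_y + 'X_v) * q) =
     ('X_y + 'X_v) * (g - ('X_i + 'X_j) * q) - (('X_y + 'X_v) * g - ('X_i + 'X_j) * r).
    by ring.
  by have [_ _ mU] := idU; apply: (idealB idU) => //; apply: mU.
suff hg : mI U (subst_neg i j g) by rewrite {1}Eq addrK.
refine (nz2 _ _).
have := subst_neg_mon (j := j) hU h.
rewrite /subst_neg rmorphB !rmorphM /= -!/(subst_neg i j _) hj subr0.
by rewrite {1}/subst_neg rmorphD /= -!/(subst_neg i j _) !hX // eq_sym.
Qed.

(** The sequence is regular on each component, which yields quotients [eA], [eC], [eB] of [g] by
    [x + u]. They are glued first over [A] and [C], then over [B]. *)
Lemma path_regular2 : ~ UC 0%MM -> (forall a, UC a -> UA a \/ UB a) ->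
  regular_seq M J [:: 'X_x + 'X_u; 'X_y + 'X_v].
Proof.
move=> C0 CAB; have [[xy xu yu uv] /andP[xv yv]] := neqs.
have hM f : f \in [:: 'X_x + 'X_u; 'X_y + 'X_v] -> M f.
  by rewrite !inE => /orP[] /eqP->; apply: max_homog_idealD.
split=> //; last exact: path_proper.
case=> [_ g /(ideal_add_nil _ idJ)/path_theta1_nzd ?|]; first exact/(ideal_add_nil _ idJ).
case=> //= _ g /(ideal_add1P _ _ idJ)[r /path_idealP[hA hC hB]].
apply/(ideal_add1P _ _ idJ).
have upP i S U : ~~ S i -> upward S U -> upward (predC1 i) U.
  move=> Si hU a b ab; apply: hU => l Sl; apply: ab => /=.
  by apply: contraNneq Si => <-.
have nz1 S U : upward S U -> ~~ S x || ~~ S u -> nzd_mod (mI U) ('X_x + 'X_u).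
  by move=> hU /orP[h|h]; [|rewrite addrC]; refine (nzdD hU _ h); rewrite // eq_sym.
have nz2 S U : upward S U -> ~~ S y || ~~ S v -> nzd_mod (mI U) ('X_y + 'X_v).
  by move=> hU /orP[h|h]; [|rewrite addrC]; refine (nzdD hU _ h); rewrite // eq_sym.
have [eA [gA rA]] : exists e, A (g - ('X_x + 'X_u) * e) /\ A (r - ('X_y + 'X_v) * e).
  by apply: component_regular hA => //; [apply: upP upA|apply: nz1 upA _|apply: nz2 upA _];
    rewrite /off ?eqxx ?andbF.
have [eC [gC rC]] : exists e, C (g - ('X_x + 'X_u) * e) /\ C (r - ('X_y + 'X_v) * e).
  rewrite [X in X * r]addrC in hC; rewrite addrC.
  by apply: component_regular hC; rewrite // 1?eq_sym //;
    [apply: upP upC|rewrite addrC; apply: nz1 upC _|apply: nz2 upC _];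
    rewrite /off ?eqxx ?andbF ?orbT.
have [eB [gB rB]] : exists e, B (g - ('X_x + 'X_u) * e) /\ B (r - ('X_y + 'X_v) * e).
  rewrite [X in X * r]addrC in hB; rewrite addrC.
  by apply: component_regular hB; rewrite // 1?eq_sym //;
    [apply: upP upB|rewrite addrC; apply: nz1 upB _|apply: nz2 upB _];
    rewrite /off ?eqxx ?andbF ?orbT.
have upO S U U' : upward S U -> upward S U' -> upward S (fun a => U a \/ U' a).
  by move=> hU hU' a b ab [/(hU a b ab)|/(hU' a b ab)]; [left|right].
have [_ _ mA] := idA; have [_ _ mB] := idB; have [_ _ mC] := idC.
(* Both [A] and [C] omit [y], so [y + v] cancels modulo [A + C]. *)
have [p [q [hp hq Epq]]] : exists p q, [/\ A p, C q & eA - eC = p + q].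
  apply: mon_ideal_split.
  have upAC : upward (predC1 y) (fun a => UA a \/ UC a).
    by apply: upO; [apply: upP upA|apply: upP upC]; rewrite /off eqxx ?andbF.
  apply: (nz2 _ _ upAC); first by rewrite /= eqxx.
  have -> : ('X_y + 'X_v) * (eA - eC) = (r - ('X_y + 'X_v) * eC) - (r - ('X_y + 'X_v) * eA).
    by ring.
  apply: (idealB (mon_ideal_ideal k (upwardW upAC))).
    by apply: mon_ideal_sub rC; right.
  by apply: mon_ideal_sub rA; left.
pose e := eA - p.
have eE : e = eC + q by rewrite /e -(subrK eC eA) Epq; ring.
have gA' : A (g - ('X_x + 'X_u) * e).
  have -> : g - ('X_x + 'X_u) * e = g - ('X_x + 'X_u) * eA - (- ('X_x + 'X_u)) * p.
    by rewrite /e; ring.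
  by apply: (idealB idA) => //; apply: mA.
have gC' : C (g - ('X_x + 'X_u) * e).
  have -> : g - ('X_x + 'X_u) * e = g - ('X_x + 'X_u) * eC - ('X_x + 'X_u) * q.
    by rewrite eE; ring.
  by apply: (idealB idC) => //; apply: mC.
have [p2 [q2 [hp2 hq2 Epq2]]] :
    exists p q, [/\ mI (fun a => UA a /\ UC a) p, B q & e - eB = p + q].
  apply: mon_ideal_split.
  (* By [CAB], [C + B] is contained in the sum of [B] and the intersection of [A] and [C]. Hence the
     correction [p2] does not disturb the gluing already done. *)
  apply: (@mon_ideal_sub _ _ (fun a => UC a \/ UB a)).
    by move=> a [Ca|Ba]; [case: (CAB a Ca); [left|right]|right].
  have upCB : upward (predC1 u) (fun a => UC a \/ UB a).
    by apply: upO; [apply: upP upC|apply: upP upB]; rewrite /off eqxx ?andbF.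
  apply: (nz1 _ _ upCB); first by rewrite /= eqxx orbT.
  have -> : ('X_x + 'X_u) * (e - eB) = (g - ('X_x + 'X_u) * eB) - (g - ('X_x + 'X_u) * e).
    by ring.
  apply: (idealB (mon_ideal_ideal k (upwardW upCB))).
    by apply: mon_ideal_sub gB; right.
  by apply: mon_ideal_sub gC'; left.
have [hpA hpC] := (mon_idealI UA UC p2).1 hp2.
exists (e - p2); apply/path_idealP.
have gE : g - ('X_x + 'X_u) * (e - p2) = g - ('X_x + 'X_u) * e - (- ('X_x + 'X_u)) * p2.
  by ring.
split.
- by rewrite gE; apply: (idealB idA) => //; apply: mA.
- by rewrite gE; apply: (idealB idC) => //; apply: mC.
have -> : g - ('X_x + 'X_u) * (e - p2) = g - ('X_x + 'X_u) * eB - ('X_x + 'X_u) * q2.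
  by rewrite -(subrK eB e) Epq2; ring.
by apply: (idealB idB) => //; apply: mB.
Qed.

(* The element [w] of the component [A], glued to [0] on [B], is a class in
   degree 1 when the variables kill [w] in [A + B] but [w] is not in [A + B]. *)
Lemma path_depth_le1 w fs : UC w -> ~ UA w -> ~ UB w ->
  (forall i, UA (U_(i) + w)%MM \/ UB (U_(i) + w)%MM) ->
  regular_seq M J fs -> (size fs <= 1)%N.
Proof.
move=> Cw nAw nBw hw; case: fs => [|f [|g fs]] //= /(regular_koszul1 idJ) K.
have [[xy xu yu uv] /andP[xv yv]] := neqs.
have [_ _ mA] := idA; have [_ _ mB] := idB; have [_ _ mC] := idC.
(* The cochain is a lift of [X_i w] modulo [A] and of 0 modulo [B]. *)
have /fin_all_exists[cJ hc] (i : 'I_n) :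
    exists c : R, [/\ A (c - 'X_i * 'X_[w]), C c & B c].
  have XC : C ('X_i * 'X_[w]) by apply: mC; apply/mon_idealX.
  case: (hw i) => h; [exists 0|exists ('X_i * 'X_[w])]; rewrite ?sub0r ?subrr.
    split; [|by case: idC|by case: idB].
    by rewrite -mulN1r; apply: mA; rewrite -mpolyXD; apply/mon_idealX.
  by split=> //; [case: idA|rewrite -mpolyXD; apply/mon_idealX].
have [|e he] := K cJ.
  move=> i j; have [Ai Ci Bi] := hc i; have [Aj Cj Bj] := hc j.
  apply/path_idealP; split; last by apply: (idealB idB) => //; apply: mB.
    2: by apply: (idealB idC) => //; apply: mC.
  have -> : 'X_i * cJ j - 'X_j * cJ i =
      'X_i * (cJ j - 'X_j * 'X_[w]) - 'X_j * (cJ i - 'X_i * 'X_[w]) by ring.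
  by apply: (idealB idA) => //; apply: mA.
(* [B] omits [u] and [A] omits [x], so these variables cancel: [e] vanishes modulo [B] and equals
   [w] modulo [A]. Comparing coefficients at [w] is then contradictory. *)
have Be : B e.
  have [_ _ Bu] := (path_idealP _).1 (he u); have [_ _ cu] := hc u.
  have nz : nzd_mod B ('X_u) by apply: mon_ideal_nzd_prime upB _ => /var_primeX; rewrite /off eqxx.
  by refine (nz _ _); rewrite -[_ * _](subKr (cJ u)); apply: (idealB idB).
have Ae : A ('X_[w] - e).
  have [Ax _ _] := (path_idealP _).1 (he x); have [cx _ _] := hc x.
  have nz : nzd_mod A ('X_x) by apply: mon_ideal_nzd_prime upA _ => /var_primeX; rewrite /off eqxx.
  refine (nz _ _); have -> : 'X_x * ('X_[w] - e) = (cJ x - 'X_x * e) - (cJ x - 'X_x * 'X_[w]) by ring.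
  exact: (idealB idA).
have := mon_ideal_coef Ae nAw; rewrite mcoeffB mcoeffX eqxx (mon_ideal_coef Be nBw).
by move/eqP; rewrite subr0 oner_eq0.
Qed.

End Path.

(** All variables but [X_p] and [X_q] kill [w], so [w] placed in position [(p, q)] is a 2-cocycle.
    It is no coboundary, because [X_p b_q - X_q b_p] has no term [w]. *)
Lemma mon_ideal_depth_le2 (k : fieldType) n (U : 'X_{1..n} -> Prop) (p q : 'I_n) (w : 'X_{1..n}) fs :
  upward predT U -> p != q -> w p = 0%N -> w q = 0%N -> ~ U w ->
  (forall i, i != p -> i != q -> U (U_(i) + w)%MM) ->
  regular_seq (@max_homog_ideal k n) (mon_ideal U) fs -> (size fs <= 2)%N.
Proof.
move=> hU pq wp wq nUw hw; have idU := mon_ideal_ideal k hU; have [_ _ mU] := idU.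
case: fs => [|f [|g [|h fs]]] //= /(regular_koszul2 idU) K.
pose s i : {mpoly k[n]} := (i == p)%:R; pose r i : {mpoly k[n]} := (i == q)%:R.
have [|b hb] := K (fun i j => (s i * r j - s j * r i) * 'X_[w]).
  (* The cocycle expression is [w] times the determinant with rows [X], [s], [r]; subtracting
     multiples of the last two rows from the first leaves the entries [z], all in the ideal. *)
  move=> i j l; pose z i := ('X_i - s i * 'X_p - r i * 'X_q) * 'X_[w].
  have hz i' : mon_ideal U (z i').
    rewrite /z /s /r; case: (eqVneq i' p) => [->|ip].
      by rewrite (negPf pq) mul1r mul0r subr0 subrr mul0r; case: idU.
    case: (eqVneq i' q) => [->|iq].
      by rewrite mul1r mul0r subr0 subrr mul0r; case: idU.
    by rewrite !mul0r !subr0 -mpolyXD; apply/mon_idealX; apply: hw.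
  have -> : 'X_i * ((s j * r l - s l * r j) * 'X_[w]) -
      'X_j * ((s i * r l - s l * r i) * 'X_[w]) + 'X_l * ((s i * r j - s j * r i) * 'X_[w]) =
      (s j * r l - s l * r j) * z i - (s i * r l - s l * r i) * z j + (s i * r j - s j * r i) * z l.
    by rewrite /z; ring.
  by case: (idU) => _ hD _; apply: hD; [apply: (idealB idU)|]; apply: mU.
have hX i c : w i = 0%N -> ('X_i * c : {mpoly k[n]})@_w = 0.
  move=> wi; have up : upward predT (fun a : 'X_{1..n} => (0 < a i)%N).
    by move=> a b' /(_ i isT) le lt; apply: leq_trans lt le.
  apply: (@mon_ideal_coef _ _ (fun a => (0 < a i)%N)); last by rewrite wi.
  have [_ _ hM] := mon_ideal_ideal k up.
  by rewrite mulrC; apply: hM; apply/mon_idealX; rewrite mnm1E eqxx.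
have := mon_ideal_coef (hb p q) nUw; rewrite mcoeffB /s /r !eqxx eq_sym (negPf pq).
rewrite mulr0 subr0 !mul1r mcoeffX eqxx mcoeffB !hX // !subr0.
by move/eqP; rewrite oner_eq0.
Qed.

(** * The construction *)

(** Superadditivity gives a product of [t] factors order at least [t]; conversely, factors of
    positive order are split off one at a time, each costing at most one. *)
Lemma mon_pow_ord n (ord : 'X_{1..n} -> nat) t a :
  (forall b c, ord b + ord c <= ord (b + c)%MM)%N ->
  (forall b, 0 < ord b -> exists c e,
     [/\ b = (c + e)%MM, (ord b).-1 <= ord c & 0 < ord e])%N ->
  mon_pow (fun b => 0 < ord b)%N t a <-> (t <= ord a)%N.
Proof.
move=> ordD ordS; elim: t a => [//|t IH] a; split.
  move=> [b [c [/IH tb c0 ->]]]; apply: leq_trans (ordD b c).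
  by rewrite -addn1 leq_add.
move=> ta; have [|b [c [aE ab c0]]] := ordS a; first exact: leq_trans ta.
exists b, c; split=> //; apply/IH; apply: leq_trans ab.
by rewrite -ltnS prednK // (leq_trans _ ta).
Qed.

Lemma mon_pow_muln n (U : 'X_{1..n} -> Prop) t c : U c -> mon_pow U t (c *+ t)%MM.
Proof.
move=> Uc; elim: t => [//|t IH]; exists (c *+ t)%MM, c; split=> //.
by apply/mnmP => i; rewrite mnmDE !mulmnE mulnS addnC.
Qed.

Lemma mnm_subK n (a : 'X_{1..n}) i e : (e <= a i)%N ->
  a = (a - U_(i) *+ e + U_(i) *+ e)%MM.
Proof.
move=> ea; apply/mnmP => j; rewrite mnmDE mnmBE mulmnE mnm1E.
by case: eqP => [<-|_]; rewrite ?mul1n ?subnK // mul0n subn0 addn0.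
Qed.

(* The order function of the ideal [(X_i ^ p, X_j, X_l ^ 2)]. *)
Definition ci_ord n (p : nat) (i j l : 'I_n) (a : 'X_{1..n}) : nat :=
  a i %/ p + a j + a l %/ 2.

Lemma mon_pow_ci n p (i j l : 'I_n) t a : (0 < p)%N -> uniq [:: i; j; l] ->
  mon_pow (fun b => 0 < ci_ord p i j l b)%N t a <-> (t <= ci_ord p i j l a)%N.
Proof.
rewrite /= !inE negb_or andbT => p0 /andP[/andP[ij il] jl].
apply: mon_pow_ord => [b c|b b0].
  rewrite /ci_ord !mnmDE.
  have h q r s : (r %/ q + s %/ q <= (r + s) %/ q)%N.
    by case: q => [|q]; [rewrite !divn0|rewrite divnD // leq_addr].
  have := h p (b i) (c i); have := h 2 (b l) (c l); lia.
have hsub s e : (e <= b s)%N -> ((ci_ord p i j l b).-1 <= ci_ord p i j l (b - U_(s) *+ e)%MM)%N ->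
    (0 < ci_ord p i j l (U_(s) *+ e)%MM)%N -> exists c e0,
     [/\ b = (c + e0)%MM, (ci_ord p i j l b).-1 <= ci_ord p i j l c
       & 0 < ci_ord p i j l e0]%N.
  by move=> es h1 h2; exists (b - U_(s) *+ e)%MM, (U_(s) *+ e)%MM; split=> //; apply: mnm_subK.
(* Positive order means that [X_i ^ p], [X_j] or [X_l ^ 2] divides; that generator is split off. *)
have := b0; rewrite {1}/ci_ord !addn_gt0 => /orP[/orP[bi|bj]|bl].
- have pb : (p <= b i)%N by rewrite leqNgt; apply: contraTN bi => /divn_small->.
  apply: (hsub i p) => //; rewrite /ci_ord ?mnmBE !mulmnE !mnm1E eqxx (negPf ij) (negPf il).
    rewrite !mul0n mul1n !subn0 -{1}(subnKC pb) divnDl // divnn p0; exact: leqnn.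
  by rewrite mul1n divnn p0.
- apply: (hsub j 1%N) => //; rewrite /ci_ord ?mnmBE !mulmnE !mnm1E eqxx (negPf jl) [j == i]eq_sym (negPf ij).
    rewrite !mul0n !subn0 !mul1n; move: (b i %/ p)%N (b l %/ 2)%N (b j) bj => r q s; lia.
  by rewrite !addn_gt0 orbT.
have lb : (2 <= b l)%N by lia.
apply: (hsub l 2%N) => //; rewrite /ci_ord ?mnmBE !mulmnE !mnm1E eqxx
    [l == i]eq_sym [l == j]eq_sym (negPf il) (negPf jl).
  rewrite !mul0n !mul1n !subn0; move: (b i %/ p)%N (b l) lb (b j) => r q q2 s; lia.
by rewrite addn_gt0 orbT.
Qed.

Lemma ci_ord_upward n p (i j l : 'I_n) (S : pred 'I_n) t : S i -> S j -> S l ->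
  upward S (fun a => t <= ci_ord p i j l a)%N.
Proof.
move=> Si Sj Sl a b ab h; apply: leq_trans h _; rewrite /ci_ord.
by rewrite !leq_add ?leq_div2r ?ab.
Qed.

Section Construction.
Variables (m d : nat).
Hypothesis m2 : (2 <= m)%N.

Local Notation mon := 'X_{1..5}.
Local Notation x := (@Ordinal 5 0 isT).
Local Notation y := (@Ordinal 5 1 isT).
Local Notation z := (@Ordinal 5 2 isT).
Local Notation u := (@Ordinal 5 3 isT).
Local Notation v := (@Ordinal 5 4 isT).
Let D := (4 * m)%N.

Lemma D_ge8 : (8 <= D)%N. Proof. by rewrite /D; lia. Qed.

(** * Weights and the powers of the middle component *)

Definition weight (a : mon) : nat := a x + a v + 2 * a z.

(* Exponents of the monomials in Q2.  A product of [t] of them of weight [t * D]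
   with [z]-exponent 1 has exactly one factor of [z]-exponent 1, and the others
   have [x]-exponent divisible by [m]. *)
Definition middle (a : mon) : Prop := (D < weight a)%N \/
  [/\ weight a = D, a z = 0 -> m %| a x & a z = 1 -> a x + 1 <> d %[mod m]]%N.

Lemma weightD a b : weight (a + b)%MM = (weight a + weight b)%N.
Proof. by rewrite /weight !mnmDE; lia. Qed.

Lemma middle_upward : upward (off y u) middle.
Proof.
move=> a b ab; have [hx hv hz] := And3 (ab x isT) (ab v isT) (ab z isT).
rewrite /middle; case: (ltnP D (weight b)) => [|wb]; first by left.
rewrite /weight in wb *; case=> [wa|[wa h0 h1]]; first by exfalso; lia.
have [Ex Ev Ez] : [/\ b x = a x, b v = a v & b z = a z] by split; lia.
by right; rewrite Ex Ev Ez.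
Qed.

Lemma mon_pow_middle t a : mon_pow middle t a ->
  (t * D <= weight a)%N /\ (weight a = t * D ->
     (a z = 0 -> m %| a x) /\ (a z = 1 -> a x + 1 <> d %[mod m]))%N.
Proof.
elim: t a => [|t IH] a.
  move=> _; split=> //; rewrite /weight mul0n => wa.
  have [-> ->] : a x = 0%N /\ a z = 0%N by lia.
  by split.
move=> [b [c [/IH[wb hb] hc ->]]].
have {hc}[wc hc] : (D <= weight c)%N /\ (weight c = D ->
     (c z = 0 -> m %| c x) /\ (c z = 1 -> c x + 1 <> d %[mod m]))%N.
  case: hc => [h|[-> h0 h1]]; last by split.
  by split=> [|E]; [exact: ltnW|rewrite E ltnn in h].
rewrite weightD mulSn; split=> [|E]; first by rewrite addnC leq_add.
have [Eb Ec] : (weight b = t * D /\ weight c = D)%N.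
  by move: wb wc E; move: (weight b) (weight c) (t * D)%N D; clear; lia.
have {hb}[hb0 hb1] := hb Eb; have {hc}[hc0 hc1] := hc Ec.
rewrite !mnmDE; split=> [|Ez].
  move=> /eqP; rewrite addn_eq0 => /andP[/eqP/hb0 ? /eqP/hc0 ?]; exact: dvdn_add.
have [[bz cz]|[bz cz]] : (b z = 0 /\ c z = 1 \/ b z = 1 /\ c z = 0)%N.
  by move: Ez; move: (b z) (c z); clear; lia.
  have /dvdnP[q ->] := hb0 bz.
  by rewrite -addnA modnMDl; apply: hc1.
have /dvdnP[q ->] := hc0 cz.
by rewrite -addnA addnCA modnMDl; apply: hb1.
Qed.

Definition mon5 (a b c : nat) : mon := [multinom nth 0%N [:: a; 0; b; 0; c] i | i < 5].

(** The factors are [q] copies of [x^m v^(D-m)] and [t - q] copies of [v^D]. *)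
Lemma mon_pow_middle_line t q : (q <= t)%N ->
  mon_pow middle t (mon5 (m * q) 0 (t * D - m * q)).
Proof.
have mD : (m <= D)%N by rewrite /D; lia.
elim: t q => [//|t IH] [|q] qt.
  exists (mon5 0 0 (t * D)), (mon5 0 0 D); split.
  - by have := IH 0%N isT; rewrite muln0 subn0.
  - by right; rewrite /weight !mnmE /= !muln0 !addn0 add0n; split.
  apply/mnmP => i; rewrite mnmDE !mnmE; case: i => [[|[|[|[|[|i]]]]] lt] //=.
    by rewrite muln0.
  by rewrite muln0 subn0 mulSn addnC.
exists (mon5 (m * q) 0 (t * D - m * q)), (mon5 m 0 (D - m)); split.
- exact: IH.
- by right; rewrite /weight !mnmE /= muln0 addn0 subnKC.
have h : (m * q <= t * D)%N by rewrite mulnC leq_mul.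
apply/mnmP => i; rewrite mnmDE !mnmE; case: i => [[|[|[|[|[|i]]]]] lt] //=.
  by rewrite mulnS addnC.
by rewrite mulnS mulSn; lia.
Qed.

(** One factor carries [z] and the residue of [t] modulo [m] as its [x]-exponent; the other [t]
    factors supply the multiple of [m]. *)
Lemma mon_pow_middle_corner t : (t.+1 <> d %[mod m])%N ->
  mon_pow middle t.+1 (mon5 t 1 (D.-1 * t.+1).-1).
Proof.
move=> td; have m0 : (0 < m)%N by lia.
have rm := ltn_pmod t m0; have tE := divn_eq t m.
exists (mon5 (m * (t %/ m)) 0 (t * D - m * (t %/ m))), (mon5 (t %% m) 1 (D - 2 - t %% m)).
split.
- by apply: mon_pow_middle_line; apply: leq_div.
- right; rewrite /weight !mnmE /=; split=> // [|_].
    by rewrite /D; move: (t %% m)%N rm => r rm; lia.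
  by rewrite modnDml addn1.
have h : (m * (t %/ m) <= t * D)%N.
  by rewrite mulnC (leq_trans (leq_trunc_div _ _)) // leq_pmulr // /D; lia.
apply/mnmP => i; rewrite mnmDE !mnmE; case: i => [[|[|[|[|[|i]]]]] lt] //=.
  by rewrite mulnC -tE.
have -> : (D.-1 * t.+1 = t * D + D - t - 1)%N.
  have : (0 < D)%N by rewrite /D; lia.
  by case: D => // D' _; rewrite /= !mulnS [(D' * t)%N]mulnC; move: (t * D')%N => r; clear; lia.
have tD : (t <= t * D)%N by rewrite leq_pmulr // (leq_trans _ D_ge8).
have mD : (m + 2 <= D)%N by move: D_ge8; rewrite /D; clear; lia.
move: h tE tD rm mD; rewrite [(_ * m)%N]mulnC.
by move: (m * (t %/ m))%N (t * D)%N (t %% m)%N D; clear; lia.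
Qed.

(** * The outer components and their comparison with the middle one *)

Let left_part t a := (t <= ci_ord D.-1 v u z a)%N.
Let right_part t a := (t <= ci_ord 1 x y z a)%N.

Lemma left_upward t : upward (off x y) (left_part t).
Proof. exact: ci_ord_upward. Qed.

Lemma right_upward t : upward (off u v) (right_part t).
Proof. exact: ci_ord_upward. Qed.

(* A monomial of the middle power outside both outer powers has weight at most
   [t * D], with equality only at [x^(t-1) v^((D-1)t-1) z]. *)
Lemma middle_sub t a : (t = d %[mod m])%N -> mon_pow middle t a ->
  left_part t a \/ right_part t a.
Proof.
move=> td /mon_pow_middle[wa ha]; rewrite /left_part /right_part.
case: leqP => [|lA]; first by left.
case: leqP => [|lB]; [by right|exfalso].
have D8 := D_ge8.
have hv : (a v < (a v %/ D.-1).+1 * D.-1)%N by apply: ltn_ceil; move: D8; move: D; clear; lia.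
move: lA lB; rewrite /ci_ord divn1 => lA lB.
pose l := (a z %/ 2)%N; have lz : (a z <= 2 * l + 1)%N.
  by rewrite /l; move: (a z); clear; lia.
rewrite -/l in lA lB.
have tl : (l < t)%N by move: lB; clearbody l; clear; lia.
have {}hv : (a v < (t - l) * D.-1)%N.
  apply: leq_trans hv _; rewrite leq_mul2r; apply/orP; right.
  by move: lA; clearbody l; move: (a v %/ D.-1)%N => r; clear; lia.
have E : (t * D = (t - l) * D.-1 + (t - l) + l * D)%N.
  rewrite -mulnSr prednK; last exact: leq_trans D8.
  by rewrite -mulnDl subnK // ltnW.
have l8 : (l * 8 <= l * D)%N by rewrite leq_mul2l D8 orbT.
(* The bounds on [a x], [a v] and [a z] add up to [weight a <= t * D - l * (D - 4)]; against
   [t * D <= weight a] this makes all of them equalities, with [l = 0]. *)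
have [l0 wE z1 xE] : [/\ l = 0, weight a = t * D, a z = 1 & a x + 1 = t]%N.
  move: wa hv E l8 lz lB tl; rewrite /weight.
  move: (a x) (a y) (a v) (a z) ((t - l) * D.-1)%N (t * D)%N (l * D)%N; clearbody l; clear.
  by move=> *; split; lia.
by have [_ /(_ z1)] := ha wE; rewrite xE.
Qed.

Lemma middleX i : (i != y) && (i != u) -> middle (U_(i) *+ D)%MM.
Proof.
have D8 := D_ge8.
case: i => [[|[|[|[|[|i]]]]] lt] //= _; rewrite /middle /weight !mulmnE !mnm1E /= !mul0n !mul1n.
- by right; split; rewrite ?muln0 ?addn0 // /D dvdn_mull.
- by left; move: D8; move: D; clear; lia.
by right; rewrite muln0 addn0; split.
Qed.

(** Start from [z^(2t)], whose weight [4t] is below [t * D], and multiply by [x], [z] or [v] as long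
    as the result stays outside the power. The exponent of [z] remains large enough for both outer
    powers. *)
Lemma middle_socle t : (0 < t)%N -> exists w : mon,
  [/\ w y = 0%N, w u = 0%N, (2 * t <= w z)%N, ~ mon_pow middle t w &
      forall i, i != y -> i != u -> mon_pow middle t (U_(i) + w)%MM].
Proof.
move=> t0.
have bound (a : mon) i : (i != y) && (i != u) -> ~ mon_pow middle t a -> (a i < D * t)%N.
  move=> hi na; rewrite ltnNge; apply/negP => le; apply: na.
  apply: (upward_mon_pow middle_upward) (mon_pow_muln t (middleX hi)) => j _.
  rewrite !mulmnE mnm1E; case: eqP => [<-|_]; last by rewrite !mul0n.
  by rewrite mul1n.
have start : ~ mon_pow middle t (mon5 0 (2 * t) 0).
  case/mon_pow_middle => h _; move: h; rewrite /weight !mnmE /=.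
  have : (t * 4 < t * D)%N by rewrite ltn_mul2l t0 (leq_trans _ D_ge8).
  by move: (t * D)%N; clear; lia.
(* Outside the power each of the three exponents is below [D * t], so [N] bounds the number of
   remaining multiplications. *)
suff main N (a : mon) : (3 * (D * t) < N + (a x + a z + a v))%N -> a y = 0%N -> a u = 0%N ->
    (2 * t <= a z)%N -> ~ mon_pow middle t a -> exists w : mon,
  [/\ w y = 0%N, w u = 0%N, (2 * t <= w z)%N, ~ mon_pow middle t w &
      forall i, i != y -> i != u -> mon_pow middle t (U_(i) + w)%MM].
  by apply: (main (3 * (D * t)).+1 _ _ _ _ _ start); rewrite ?mnmE //= leq_addr.
elim: N a => [|N IH] a hN ay au az na.
  have [hx hz hv] := And3 (bound a x isT na) (bound a z isT na) (bound a v isT na).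
  exfalso; move: hN hx hz hv; move: (D * t)%N (a x) (a z) (a v); clear; lia.
case: (classic (forall i, i != y -> i != u -> mon_pow middle t (U_(i) + a)%MM)).
  by exists a.
move=> nex; have [i [iy iu ni]] : exists i,
    [/\ i != y, i != u & ~ mon_pow middle t (U_(i) + a)%MM].
  apply: NNPP => h; apply: nex => i iy iu; apply: NNPP => ni; apply: h.
  by exists i.
apply: (IH (U_(i) + a)%MM) ni; rewrite !mnmDE !mnm1E ?(negPf iy) ?(negPf iu) ?ay ?au //.
  move: hN; move: (D * t)%N (a x) (a z) (a v) => D' r q s.
  by move: iy iu; case: i => [[|[|[|[|[|i]]]]] lt] //= _ _; clear; lia.
exact: leq_trans az (leq_addl _ _).
Qed.

(* [Some true], [None], [Some false] index Q1, Q2, Q3. *)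
Definition component (i : option bool) (a : mon) : Prop :=
  match i with
  | None => middle a
  | Some true => (0 < ci_ord D.-1 v u z a)%N
  | Some false => (0 < ci_ord 1 x y z a)%N
  end.

Definition component_off (i : option bool) : pred 'I_5 :=
  match i with
  | None => off y u
  | Some true => off x y
  | Some false => off u v
  end.

Lemma component_pow t a : (forall i, mon_pow (component i) t a) <->
  [/\ left_part t a, mon_pow middle t a & right_part t a].
Proof.
have D1 : (0 < D.-1)%N by move: D_ge8; move: D; clear; lia.
have L : mon_pow (component (Some true)) t a <-> left_part t a by apply: mon_pow_ci.
have Rr : mon_pow (component (Some false)) t a <-> right_part t a by apply: mon_pow_ci.
split=> [h|[hL hC hR] [[]|]]; [|exact/L|exact/Rr|exact: hC].
by split; [apply/L|exact: (h None)|apply/Rr].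
Qed.

Lemma component_symbolic (k : fieldType) t f :
  symbolic_power (mon_ideal (k := k) (fun a => forall i, component i a)) t f <->
  mon_ideal (fun a => [/\ left_part t a, mon_pow middle t a & right_part t a]) f.
Proof.
have D8 := D_ge8.
have Dp : (D %/ D.-1 != 0)%N.
  by rewrite -lt0n divn_gt0; move: D8; move: D; clear; lia.
(* Each monomial avoids its own prime and lies in the other two components: [y u] in Q1 and Q3,
   [x^D] in Q2 and Q3, [v^D] in Q1 and Q2. *)
pose e (i : option bool) : mon := match i with
  | None => (U_(y) + U_(u))%MM | Some true => (U_(x) *+ D)%MM | Some false => (U_(v) *+ D)%MM end.
have -> : symbolic_power (mon_ideal (k := k) (fun a => forall i, component i a)) t f <->
    mon_ideal (fun a => forall i, mon_pow (component i) t a) f.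
  apply: (@symbolic_power_mon _ _ _ component_off component e D).
  - case=> [[]|]; [exact: left_upward 1%N|exact: right_upward 1%N|exact: middle_upward].
  - case=> [[]|] j hj; last exact: middleX.
    + rewrite /= /ci_ord !mulmnE !mnm1E; move: hj Dp D8.
      case: j => [[|[|[|[|[|j]]]]] lt] //= _; rewrite ?mul0n ?mul1n ?div0n //;
        by move: (D %/ D.-1)%N D; clear; lia.
    rewrite /= /ci_ord !mulmnE !mnm1E; move: hj D8.
    case: j => [[|[|[|[|[|j]]]]] lt] //= _; rewrite ?mul0n ?mul1n ?div0n ?divn1 //;
      by move: D; clear; lia.
  - by case=> [[]|] j; case: j => [[|[|[|[|[|j]]]]] lt] //= _; rewrite /e ?mnmDE ?mulmnE !mnm1E.
  - case=> [[]|] [[]|] // _; rewrite /e; first [exact: middleX|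
      rewrite /component /ci_ord ?mnmDE ?mulmnE !mnm1E /= ?mul0n ?mul1n ?divn1 ?div0n ?addn0 //].
    + exact: leq_trans D8.
    by rewrite lt0n.
  case=> [[]|] /=; rewrite ?/middle ?/ci_ord ?/weight !mnm0E ?div0n //.
  by case=> [//|[h]]; move: D8; rewrite -h.
by split; apply: mon_ideal_sub => a; rewrite component_pow.
Qed.

Lemma construction_depth (k : fieldType) t : (0 < t)%N ->
  depth_eq (@max_homog_ideal k 5)
    (symbolic_power (mon_ideal (k := k) (fun a => forall i, component i a)) t)
    (if t == d %[mod m] then 2%N else 1%N).
Proof.
move=> t0; set Q := symbolic_power _ t.
have -> : Q = mon_ideal (fun a => [/\ left_part t a, mon_pow middle t a & right_part t a]).
  apply: functional_extensionality => f; apply: propositional_extensionality.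
  exact: component_symbolic.
have upL := @left_upward t; have upM := upward_mon_pow (t := t) middle_upward.
have upR := @right_upward t; have xyuv : uniq [:: x; y; u; v] by [].
have M0 : ~ mon_pow middle t 0%MM.
  move=> /mon_pow_middle[+ _]; have -> : weight 0%MM = 0%N by rewrite /weight !mnm0E.
  have : (0 < t * D)%N by rewrite muln_gt0 t0 (leq_trans _ D_ge8).
  by move: (t * D)%N; clear; lia.
case: eqP => [td|td].
  split.
    exists [:: 'X_x + 'X_u; 'X_y + 'X_v]; split=> //.
    by apply: (path_regular2 k xyuv upL upM upR M0) => a; apply: middle_sub.
  have [w [wy wu wz nw hw]] := middle_socle t0.
  move=> fs; apply: (@mon_ideal_depth_le2 _ _ _ y u w) => //.
  - move=> a b ab [hL hM hR].
    by split; [apply: upL hL|apply: upM hM|apply: upR hR] => i _; apply: ab.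
  - by case.
  move=> i iy iu; have hz : (2 * t <= (U_(i) + w)%MM z)%N.
    by rewrite mnmDE (leq_trans wz) ?leq_addl.
  have ht : (t <= (U_(i) + w)%MM z %/ 2)%N by rewrite leq_divRL // mulnC.
  by split; [|exact: hw|]; apply: leq_trans ht (leq_addl _ _).
split; first by exists [:: 'X_x + 'X_u]; split=> //; apply: (path_regular1 k xyuv upL upM upR M0).
case: t t0 td Q upL upM upR M0 => // t _ td _ upL upM upR _.
have D8 := D_ge8.
(* With the exponent now written [t.+1], this monomial has order exactly [t] for both outer
   components, one short of membership. Multiplying by [x], [y] or [z] raises the right order, by
   [u] or [v] the left one. *)
pose w := mon5 t 1 (D.-1 * t.+1).-1.
have D1 : (0 < D.-1)%N by move: D8; move: D; clear; lia.
have Ew : ((D.-1 * t.+1).-1 %/ D.-1 = t)%N.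
  have -> : (D.-1 * t.+1).-1 = (t * D.-1 + D.-1.-1)%N.
    by rewrite mulnSr mulnC; case: D.-1 D1 => // D' _; rewrite addnS.
  by rewrite divnMDl // divn_small ?addn0 // prednK.
have vS : ((D.-1 * t.+1).-1.+1 = D.-1 * t.+1)%N by rewrite prednK // muln_gt0 D1.
have ordL : ci_ord D.-1 v u z w = t by rewrite /ci_ord !mnmE /= Ew !addn0.
have ordR : ci_ord 1 x y z w = t by rewrite /ci_ord !mnmE /= divn1 !addn0.
move=> fs; apply: (path_depth_le1 xyuv upL upM upR (w := w)).
- exact: mon_pow_middle_corner.
- by rewrite /left_part ordL ltnn.
- by rewrite /right_part ordR ltnn.
rewrite /left_part /right_part /ci_ord => i; rewrite !mnmDE !mnm1E !mnmE.
case: i => [[|[|[|[|[|i]]]]] lt] //=; rewrite ?add0n ?add1n ?divn1 ?addn0.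
- by right; rewrite ltnS.
- by right; rewrite addn1.
- by right; rewrite addn1.
- by left; rewrite Ew addn1.
by left; rewrite vS mulKn.
Qed.

End Construction.

Theorem theorem4p4 (k : fieldType) (m d : nat) :
  (2 <= m)%N -> (d < m)%N ->
  exists K : {mpoly k[5]} -> Prop,
    is_monomial_ideal K /\
    forall t : nat, (1 <= t)%N ->
      depth_eq (@max_homog_ideal k 5) (symbolic_power K t)
               (if t == d %[mod m] then 2%N else 1%N).
Proof.
move=> m2 _; exists (mon_ideal (fun a => forall i, component m d i a)).
split; last by move=> t; apply: construction_depth.
apply: mon_ideal_monomial => a b ab h i; move: (h i).
by case: i => [[]|]; [apply: (left_upward (t := 1))|apply: (right_upward (t := 1))|
  apply: (middle_upward m2)] => j _; apply: ab.
Qed.
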